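(* There exist universal constants $c,c_1>0$ such that the following holds. Let $n\in\mathbb{N}$, $\sigma^2>0$ and $0<\tau_1\le\dots\le\tau_n$, and consider the oracle class $\mathcal{O}_{\tau_1,\dots,\tau_n}^{\mathrm{conv},\sigma^2}$. Fix any $R,L,\varepsilon>0$ such that $\sqrt{L}\,R>c_1\sqrt{\varepsilon}>0$. For any $$t\le c\left[\tau_n\frac{\sqrt{L}\,R}{\sqrt{\varepsilon}}+\left(\frac1n\sum_{i=1}^n\tau_i\right)\frac{\sigma^2R^2}{n\varepsilon^2}\right]$$ and any algorithm $A\in\mathcal{A}_{\mathrm{zr}}$, there exist a convex set $Q$, a function $f\in\mathcal{F}^{\mathrm{conv}}_{Q,L}$, and oracles and distributions $((O_1,\dots,O_n),(\mathcal{D}_1,\dots,\mathcal{D}_n))\in\mathcal{O}_{\tau_1,\dots,\tau_n}^{\mathrm{conv},\sigma^2}(f)$ such that the points generated by the time multiple oracles protocol satisfy $$\mathbb{E}\left[f(x^{k(t)})\right]-\inf_{x\in Q}f(x)>\varepsilon,$$ where $k(t)$ is the largest index such that $t^{k(t)}\le t$, and where $R$ is the Euclidean distance between the starting point $0$ and the closest minimizer $x_*\in Q$ of $f$ over $Q$.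
   Context: $[n]=\{1,\dots,n\}$; $\|\cdot\|$ is the Euclidean norm. Function class $\mathcal{F}^{\mathrm{conv}}_{Q,L}$ (for a convex set $Q\subseteq\mathbb{R}^d$): all functions $f:\mathbb{R}^d\to\mathbb{R}$ that are convex, differentiable and $L$-smooth on $Q$, i.e., $\|\nabla f(x)-\nabla f(y)\|\le L\|x-y\|$ for all $x,y\in Q$. Algorithm class $\mathcal{A}_{\mathrm{zr}}$: an algorithm is a sequence $A=\{A^k\}_{k\ge0}$ with $A^0\in\mathbb{R}_{\ge0}\times[n]\times\mathbb{R}^d$ and $A^k:(\mathbb{R}^d)^k\to\mathbb{R}_{\ge0}\times[n]\times\mathbb{R}^d$ for $k\ge1$. Writing $(t^{k+1},i^{k+1},x^k)=A^k(g^1,\dots,g^k)$, it is required that $t^{k+1}\ge t^k$ for all $k\ge1$ and all $g^1,\dots,g^k\in\mathbb{R}^d$, and that $x^k\in Q$ for all $k\ge0$. The algorithm may depend on $d$ and $Q$: it is a rule that gives such a sequence for each dimension $d$ and each set $Q$. We put $t^0=0$, and the times are assumed to be such that $k(t)$ is well defined. Time multiple oracles protocol (input: $f$, oracles $O_1,\dots,O_n$, distributions $\mathcal{D}_1,\dots,\mathcal{D}_n$, algorithm $A$): set $s_i^0=(0,0,0)$ for all $i\in[n]$. For $k=0,1,2,\dots$: compute $(t^{k+1},i^{k+1},x^k)=A^k(g^1,\dots,g^k)$; draw $\xi^{k+1}\sim\mathcal{D}_{i^{k+1}}$ independently; compute $(s^{k+1}_{i^{k+1}},g^{k+1})=O_{i^{k+1}}(t^{k+1},x^k,s^k_{i^{k+1}},\xi^{k+1})$;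 and set $s_j^{k+1}=s_j^k$ for all $j\ne i^{k+1}$. Delayed oracle: for $\tau>0$ and a stochastic mapping $\nabla g(\cdot;\cdot)$, the oracle $O_\tau^{\nabla g}$ takes a time $t\ge0$, a point $x\in\mathbb{R}^d$, a state $(s_t,s_x,s_q)\in\mathbb{R}_{\ge0}\times\mathbb{R}^d\times\{0,1\}$ and a sample $\xi$, and returns a new state and a vector: $$O_\tau^{\nabla g}(t,x,(s_t,s_x,s_q),\xi)=\begin{cases}((t,x,1),\,0), & s_q=0,\\ ((s_t,s_x,1),\,0), & s_q=1,\ t<s_t+\tau,\\ ((0,0,0),\,\nabla g(s_x;\xi)), & s_q=1,\ t\ge s_t+\tau.\end{cases}$$ Oracle class $\mathcal{O}_{\tau_1,\dots,\tau_n}^{\mathrm{conv},\sigma^2}$ (heterogeneous setting): for $f\in\mathcal{F}^{\mathrm{conv}}_{Q,L}$ with $f=\frac1n\sum_{i=1}^n f_i$, where $f_i$ is the local function of worker $i$ (the $f_i$ may be different), the elements of $\mathcal{O}_{\tau_1,\dots,\tau_n}^{\mathrm{conv},\sigma^2}(f)$ are the oracles $O_i=O_{\tau_i}^{\nabla f_i}$ together with distributions $\mathcal{D}_i$, $i\in[n]$, such that $\nabla f_i(\cdot;\cdot)$ is an unbiased, $\sigma^2$-variance-bounded mapping on $Q$: for all $x\in Q$, $\mathbb{E}_{\xi\sim\mathcal{D}_i}[\nabla f_i(x;\xi)]=\nabla f_i(x)$ and $\mathbb{E}_{\xi\sim\mathcal{D}_i}[\|\nabla f_i(x;\xi)-\nabla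 f_i(x)\|^2]\le\sigma^2$. *)

(* Defs.v *)
From HB Require Import structures.
From mathcomp Require Import all_boot all_order all_algebra.
From mathcomp Require Import all_classical all_reals all_analysis.
Import Order.TTheory GRing.Theory Num.Theory.
Import numFieldNormedType.Exports.

Set Implicit Arguments.
Unset Strict Implicit.
Unset Printing Implicit Defensive.

Local Open Scope classical_set_scope.
Local Open Scope ring_scope.

(* The norm that the library puts on 'rV[R]_d is the max norm. It induces the
   same topology, hence the same notion of differentiability, but metric
   statements have to use the Euclidean norm. *)
Definition enorm (R : realType) (d : nat) (x : 'rV[R]_d) : R :=
  Num.sqrt (\sum_(j < d) x ord0 j ^+ 2).

Definition gradient (R : realType) (d : nat) (f : 'rV[R]_d -> R)
    (x : 'rV[R]_d) : 'rV[R]_d :=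
  \row_(j < d) 'D_(delta_mx ord0 j) f x.

Definition smooth_convex_class (R : realType) (d : nat) (Q : set 'rV[R]_d)
    (L : R) (f : 'rV[R]_d -> R) : Prop :=
  [/\ convex_function Q f,
      forall x, Q x -> differentiable f x
    & forall x y, Q x -> Q y ->
        enorm (gradient f x - gradient f y) <= L * enorm (x - y)].

Definition is_minimizer (R : realType) (d : nat) (Q : set 'rV[R]_d)
    (f : 'rV[R]_d -> R) (x : 'rV[R]_d) : Prop :=
  Q x /\ forall y, Q y -> f x <= f y.

Definition closest_minimizer_dist (R : realType) (d : nat) (Q : set 'rV[R]_d)
    (f : 'rV[R]_d -> R) (r : R) : Prop :=
  (exists2 x, is_minimizer Q f x & enorm x = r) /\
  (forall x, is_minimizer Q f x -> r <= enorm x).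

(* Workers are indexed from 0: there are n.+1 of them, and the slowest one
   is ord_max. *)

(* The triple (t^{k+1}, i^{k+1}, x^k). *)
Record query (R : realType) (n d : nat) := Query {
  qtime : R;
  qworker : 'I_n.+1;
  qpoint : 'rV[R]_d }.

(* A^k is the restriction of the function to sequences of length k. *)
Definition algorithm (R : realType) (n d : nat) :=
  seq 'rV[R]_d -> query R n d.

(* The last condition says that the times t^k are unbounded along every
   sequence of vectors: since they are nondecreasing, it holds if and only if
   for every t >= 0 there is a largest k with t^k <= t. *)
Definition admissible_algorithm (R : realType) (n d : nat) (Q : set 'rV[R]_d)
    (A : algorithm R n d) : Prop :=
  [/\ forall gs, 0 <= qtime (A gs),
      forall gs g, qtime (A gs) <= qtime (A (rcons gs g)),
      forall gs, Q (qpoint (A gs))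
    & forall (g : nat -> 'rV[R]_d) (t : R),
        exists k, t < qtime (A (mkseq g k))].

(* Q must be nonempty because the points x^k are required to lie in Q. *)
Definition zr_class (R : realType) (n : nat)
    (A : forall d, set 'rV[R]_d -> algorithm R n d) : Prop :=
  forall d (Q : set 'rV[R]_d),
    convex_set Q -> Q !=set0 -> admissible_algorithm Q (A d Q).

Record oracle_state (R : realType) (d : nat) := OracleState {
  s_t : R;
  s_x : 'rV[R]_d;
  s_q : bool }.

Definition oracle (R : realType) (d : nat) (S : Type) :=
  R -> 'rV[R]_d -> oracle_state R d -> S -> oracle_state R d * 'rV[R]_d.

Definition delayed_oracle (R : realType) (d : nat) (S : Type) (tau : R)
    (G : 'rV[R]_d -> S -> 'rV[R]_d) : oracle R d S :=
  fun t x s xi =>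
    if ~~ s_q s then (OracleState t x true, 0)
    else if t < s_t s + tau then (OracleState (s_t s) (s_x s) true, 0)
    else (OracleState 0 0 false, G (s_x s) xi).

Definition unbiased_on (R : realType) (d : nat) (disp : measure_display)
    (S : measurableType disp) (D : probability S R) (Q : set 'rV[R]_d)
    (f : 'rV[R]_d -> R) (G : 'rV[R]_d -> S -> 'rV[R]_d) : Prop :=
  forall x, Q x -> forall j : 'I_d,
    D.-integrable [set: S] (fun xi => (G x xi ord0 j)%:E) /\
    'E_D[fun xi => G x xi ord0 j]%E = (gradient f x ord0 j)%:E.

Definition variance_bounded_on (R : realType) (d : nat)
    (disp : measure_display) (S : measurableType disp) (D : probability S R)
    (Q : set 'rV[R]_d) (sigma2 : R) (f : 'rV[R]_d -> R)
    (G : 'rV[R]_d -> S -> 'rV[R]_d) : Prop :=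
  forall x, Q x ->
    ('E_D[fun xi => (enorm (G x xi - gradient f x) ^+ 2)%R] <= sigma2%:E)%E.

Definition oracle_class (R : realType) (n d : nat) (Q : set 'rV[R]_d)
    (tau : 'I_n.+1 -> R) (sigma2 : R) (f : 'rV[R]_d -> R)
    (disp : measure_display) (S : measurableType disp)
    (O : 'I_n.+1 -> oracle R d S) (D : 'I_n.+1 -> probability S R) : Prop :=
  exists (fi : 'I_n.+1 -> 'rV[R]_d -> R)
         (G : 'I_n.+1 -> 'rV[R]_d -> S -> 'rV[R]_d),
    [/\ forall x, f x = n.+1%:R^-1 * \sum_(i < n.+1) fi i x,
        forall i x, Q x -> differentiable (fi i) x,
        forall i, O i = delayed_oracle (tau i) (G i),
        forall i, unbiased_on (D i) Q (fi i) (G i)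
      & forall i, variance_bounded_on (D i) Q sigma2 (fi i) (G i)].

Section Protocol.
Context (R : realType) (n d : nat) (S : Type).
Variables (A : algorithm R n d) (O : 'I_n.+1 -> oracle R d S).

(* xi k i is the sample that worker i would use at step k; the sample
   xi^{k+1} of the protocol is thus xi k i^{k+1}. *)
Variable xi : nat -> 'I_n.+1 -> S.

(* The answers g^1, ..., g^k and the states s_j^k. *)
Fixpoint run (k : nat) : seq 'rV[R]_d * ('I_n.+1 -> oracle_state R d) :=
  match k with
  | 0 => ([::], fun=> OracleState 0 0 false)
  | k'.+1 =>
      let: (gs, s) := run k' in
      let: q := A gs in
      let: i := qworker q in
      let: (s', g) := O i (qtime q) (qpoint q) (s i) (xi k' i) in
      (rcons gs g, fun j => if j == i then s' else s j)
  end.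

Definition iterate (k : nat) : 'rV[R]_d := qpoint (A (run k).1).

Definition iter_time (k : nat) : R :=
  if k is k'.+1 then qtime (A (run k').1) else 0.

Definition last_index (t : R) : nat :=
  xget 0 [set k | iter_time k <= t /\
                  forall j, iter_time j <= t -> (j <= k)%N].

End Protocol.

Definition mutually_independent (R : realType) (dO dS : measure_display)
    (Om : measurableType dO) (S : measurableType dS) (P : probability Om R)
    (I : choiceType) (X : I -> Om -> S) : Prop :=
  forall (J : seq I) (B : I -> set S), uniq J ->
    (forall j, measurable (B j)) ->
    P (\bigcap_(j in [set` J]) (X j @^-1` B j)) =
    (\prod_(j <- J) P (X j @^-1` B j))%E.

(* Independent samples with laws D i, one for each step and each worker. The
   protocol reads the entry of the worker chosen at step k, which depends only
   on the previous samples; so the entry read is, given the past, distributed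
   as D i^{k+1} and independent of the past. *)
Definition independent_samples (R : realType) (n : nat)
    (dO dS : measure_display) (Om : measurableType dO)
    (S : measurableType dS) (P : probability Om R)
    (D : 'I_n.+1 -> probability S R) (xi : nat * 'I_n.+1 -> Om -> S) : Prop :=
  [/\ forall p, measurable_fun [set: Om] (xi p),
      forall p (B : set S), measurable B -> P (xi p @^-1` B) = D p.2 B
    & mutually_independent P xi].

(* Main.v *)
Require Import Defs.
From HB Require Import structures.
From mathcomp Require Import all_boot all_order all_algebra.
From mathcomp Require Import all_classical all_reals all_analysis.
From mathcomp Require Import ring lra zify.
Import Order.TTheory GRing.Theory Num.Theory.
Import numFieldNormedType.Exports.

(* Since t <= c (T1 + T2) implies t <= 2 c max(T1, T2), each of the two terms
   needs its own hard instance.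

   Term with tau_n. Only the slowest worker has a nonzero local function, and
   it answers with exact gradients, so at most m = floor(t / tau_n) gradients
   are learned before time t. The function is the quadratic chain
     L/8 ((a - <v_0, x>)^2 + sum_(1 <= j <= m) (<v_(j-1), x> - <v_j, x>)^2)
   along an orthonormal family v that is built against the algorithm: v_j is
   orthogonal to the points at which the first j + 1 gradients are learned,
   which only depend on v_0, ..., v_(j-1), and v_m is orthogonal to the output.
   Then the m + 1 increments of the chain at the output sum to a, and the gap is
   at least L a^2 / (8 (m + 1)) by Cauchy-Schwarz.

   Stochastic term. On the segment [-r, r], f_i is s delta_i x for a common
   sign s, with delta_i proportional to tau_i, and the stochastic gradient is
   s delta_i / p_i with probability p_i, about delta_i^2 / sigma^2, and 0
   otherwise. The expected number of nonzero answers before time t is at most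
   sum_i (t / tau_i) p_i <= 1/2, so with probability at least 1/2 the algorithm
   follows the run in which all answers are 0. That run does not depend on s,
   so s can be chosen to make its output bad. *)

Set Implicit Arguments.
Unset Strict Implicit.
Unset Printing Implicit Defensive.

Local Open Scope classical_set_scope.
Local Open Scope ring_scope.

(** * Runs of the protocol *)

Section ProtocolFacts.
Context {R : realType} {n d : nat} {S : Type}.
Variables (Q : set 'rV[R]_d) (A : algorithm R n d).
Hypothesis admA : admissible_algorithm Q A.

Section AnyOracle.
Variables (O : 'I_n.+1 -> oracle R d S) (xi : nat -> 'I_n.+1 -> S).

Lemma run_answersS k :
  exists g, (run A O xi k.+1).1 = rcons (run A O xi k).1 g.
Proof.
rewrite /=; case: (run A O xi k) => gs s /=.
by case: (O _ _ _ _) => s' g; exists g.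
Qed.

(** Presents all answer lists as prefixes of one infinite sequence, the form in which admissibility
    states that the times are unbounded. *)
Lemma run_answers_mkseq :
  exists g : nat -> 'rV[R]_d, forall k, (run A O xi k).1 = mkseq g k.
Proof.
have [g gP] := choice run_answersS.
by exists g; elim=> [//|k IH]; rewrite gP mkseqS IH.
Qed.

Lemma iter_timeS k : iter_time A O xi k <= iter_time A O xi k.+1.
Proof.
case: admA => h0 h1 _ _; case: k => [|k]; first exact: h0.
by rewrite /iter_time; have [g ->] := run_answersS k; apply: h1.
Qed.

Lemma iter_time_homo : {homo iter_time A O xi : j k / (j <= k)%N >-> j <= k}.
Proof. by apply: homo_leq => [x|y x z|k]; [|apply: le_trans|apply: iter_timeS]. Qed.

Lemma last_index_eq t k :
  iter_time A O xi k <= t -> t < iter_time A O xi k.+1 ->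
  last_index A O xi t = k.
Proof.
move=> le_kt lt_tk.
have bound j : iter_time A O xi j <= t -> (j <= k)%N.
  move=> le_jt; rewrite leqNgt; apply/negP => /iter_time_homo le_kj.
  by move: (lt_le_trans lt_tk (le_trans le_kj le_jt)); rewrite ltxx.
rewrite /last_index; case: xgetP => [j _ [le_jt max_j]|]; last first.
  by move=> /(_ k); case; split.
by apply/eqP; rewrite eqn_leq bound // max_j.
Qed.

Lemma last_indexP t (t0 : 0 <= t) :
  iter_time A O xi (last_index A O xi t) <= t <
    iter_time A O xi (last_index A O xi t).+1.
Proof.
have [g gP] := run_answers_mkseq.
have [_ _ _ /(_ g t)[K ltK]] := admA.
have ubK j : iter_time A O xi j <= t -> (j <= K)%N.
  move=> le_jt; rewrite leqNgt; apply/negP => /iter_time_homo.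
  by rewrite /= gP => /le_trans/(_ le_jt); rewrite leNgt ltK.
have ex0 : exists j, iter_time A O xi j <= t by exists 0%N.
pose k := ex_maxn ex0 ubK.
have [le_kt max_k] : iter_time A O xi k <= t /\
    forall j, iter_time A O xi j <= t -> (j <= k)%N.
  by rewrite /k; case: ex_maxnP.
have lt_tk : t < iter_time A O xi k.+1.
  by rewrite ltNge; apply/negP => /max_k; rewrite ltnn.
by rewrite (last_index_eq le_kt lt_tk) le_kt.
Qed.

End AnyOracle.

(** With K the last index, [t^(K+1)] is computed from the first K answers, so another run that
    agrees up to K also passes [t] right after K. *)
Lemma last_index_run (O O' : 'I_n.+1 -> oracle R d S) xi xi' t (t0 : 0 <= t) :
  run A O xi (last_index A O xi t) = run A O' xi' (last_index A O xi t) ->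
  last_index A O' xi' t = last_index A O xi t.
Proof.
have /andP[] := last_indexP O xi t0.
set K := last_index _ _ _ _ => leK ltK eq_run.
apply: last_index_eq; last by rewrite /= -eq_run.
apply: le_trans leK; case: (K) eq_run => // k.
have [g gP] := run_answers_mkseq O xi; have [g' gP'] := run_answers_mkseq O' xi'.
move=> /(congr1 fst); rewrite gP gP' !mkseqS => /rcons_inj[eq_g _].
by rewrite /iter_time gP gP' eq_g.
Qed.

Variable tau : 'I_n.+1 -> R.

Definition turn (p : seq 'rV[R]_d * ('I_n.+1 -> oracle_state R d)) : 'I_n.+1 :=
  qworker (A p.1).

Definition asked (p : seq 'rV[R]_d * ('I_n.+1 -> oracle_state R d)) : 'rV[R]_d :=
  s_x (p.2 (turn p)).

Definition responds (p : seq 'rV[R]_d * ('I_n.+1 -> oracle_state R d)) : bool :=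
  s_q (p.2 (turn p)) &&
  (s_t (p.2 (turn p)) + tau (turn p) <= qtime (A p.1)).

(** Neither [G] nor the samples occur here: they affect a run only through the answers. *)
Definition next_states (p : seq 'rV[R]_d * ('I_n.+1 -> oracle_state R d)) :
    'I_n.+1 -> oracle_state R d :=
  fun j => if j == turn p then
      if responds p then OracleState 0 0 false
      else if s_q (p.2 j) then OracleState (s_t (p.2 j)) (s_x (p.2 j)) true
      else OracleState (qtime (A p.1)) (qpoint (A p.1)) true
    else p.2 j.

Definition drun (G : 'I_n.+1 -> 'rV[R]_d -> S -> 'rV[R]_d)
    (xi : nat -> 'I_n.+1 -> S) (k : nat) :=
  run A (fun i => delayed_oracle (tau i) (G i)) xi k.

Lemma drunS G xi k : drun G xi k.+1 =
  (rcons (drun G xi k).1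
     (if responds (drun G xi k) then
        G (turn (drun G xi k)) (asked (drun G xi k)) (xi k (turn (drun G xi k)))
      else 0),
   next_states (drun G xi k)).
Proof.
rewrite /drun /=; set p := run _ _ _ _; case: p => gs s /=.
rewrite /delayed_oracle /next_states /responds /asked /turn /=.
case: ifPn => [/negPf sq|/negPn sq].
  rewrite sq /=; congr pair; apply/funext => j.
  by case: eqP => // ->; rewrite sq.
rewrite sq /= leNgt; case: ifPn => lt_t /=; congr pair; apply/funext => j;
  by case: eqP => // ->; rewrite sq.
Qed.

Definition nresponses G xi (i : 'I_n.+1) (K : nat) : nat :=
  (\sum_(k < K) (responds (drun G xi k) && (turn (drun G xi k) == i)))%N.

Lemma nresponsesS G xi i K : nresponses G xi i K.+1 =
  (nresponses G xi i K + (responds (drun G xi K) && (turn (drun G xi K) == i)))%N.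
Proof. by rewrite /nresponses big_ord_recr. Qed.

Lemma leq_nresponses G xi i : {homo nresponses G xi i : j k / (j <= k)%N}.
Proof.
apply: homo_leq => [//|j k l|k]; first exact: leq_trans.
by rewrite nresponsesS leq_addr.
Qed.

(* While a request is pending, its start time already bounds the time spent on
   the previous ones. *)
Lemma nresponses_time G xi i K : 0 <= tau i ->
  tau i * (nresponses G xi i K)%:R
    <= iter_time A (fun i => delayed_oracle (tau i) (G i)) xi K.
Proof.
move=> tau0; have time_run k :
    iter_time A (fun i => delayed_oracle (tau i) (G i)) xi k.+1 =
    qtime (A (drun G xi k).1) by [].
suff [] : tau i * (nresponses G xi i K)%:R
    <= iter_time A (fun i => delayed_oracle (tau i) (G i)) xi K /\
  (s_q ((drun G xi K).2 i) ->
     tau i * (nresponses G xi i K)%:R <= s_t ((drun G xi K).2 i)) by [].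
elim: K => [|K [IH1 IH2]].
  by rewrite /nresponses big_ord0 mulr0.
have := iter_timeS (fun i => delayed_oracle (tau i) (G i)) xi K.
rewrite nresponsesS time_run drunS /= => /(le_trans IH1) {}IH1.
rewrite /next_states; set p := drun G xi K in IH1 IH2 *.
case: (eqVneq i (turn p)) => [ei|ni]; last first.
  by rewrite andbF addn0.
(* A response comes at least [tau i] after the start of its request, and [IH2] charges all earlier
   responses to the time before that start. *)
case: (boolP (responds p)) => [/andP[sq le_t]|nresp] /=.
  split=> //; rewrite natrD mulrDr mulr1.
  by apply: le_trans le_t; rewrite -ei lerD2r IH2 // ei.
rewrite addn0; split=> //.
by case: ifP => //= sq _; apply: IH2.
Qed.

(** [G] and the samples are read only at responding steps, so it is enough to compare answers there,
    along the first run. *)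
Lemma drun_agree G G' xi xi' K :
  (forall k, (k < K)%N -> responds (drun G xi k) ->
    G (turn (drun G xi k)) (asked (drun G xi k)) (xi k (turn (drun G xi k))) =
    G' (turn (drun G xi k)) (asked (drun G xi k)) (xi' k (turn (drun G xi k)))) ->
  drun G xi K = drun G' xi' K.
Proof.
elim: K => [//|K IH] agree; rewrite !drunS -IH => [|k ltk]; last first.
  by apply: agree; rewrite ltnS ltnW.
by case: ifP => // resp; rewrite agree.
Qed.

End ProtocolFacts.

(** * Euclidean space and sums of squares *)

Section EuclideanSpace.
Context {R : realType} {d : nat}.
Implicit Types (x y z a : 'rV[R]_d).

Definition dot x y : R := \sum_(j < d) x ord0 j * y ord0 j.

Lemma dotC x y : dot x y = dot y x.
Proof. by apply: eq_bigr => j _; rewrite mulrC. Qed.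

Lemma dotDr x y z : dot x (y + z) = dot x y + dot x z.
Proof. by rewrite -big_split; apply: eq_bigr => j _; rewrite mxE mulrDr. Qed.

Lemma dotZr k x y : dot x (k *: y) = k * dot x y.
Proof. by rewrite big_distrr; apply: eq_bigr => j _; rewrite mxE mulrCA. Qed.

Lemma dotNr x y : dot x (- y) = - dot x y.
Proof. by rewrite -scaleN1r dotZr mulN1r. Qed.

Lemma dotBr x y z : dot x (y - z) = dot x y - dot x z.
Proof. by rewrite dotDr dotNr. Qed.

Lemma dot0r x : dot x 0 = 0.
Proof. by rewrite -(scale0r x) dotZr mul0r. Qed.

Lemma dotZl k x y : dot (k *: x) y = k * dot x y.
Proof. by rewrite dotC dotZr dotC. Qed.

Lemma dotBl x y z : dot (y - z) x = dot y x - dot z x.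
Proof. by rewrite !(dotC _ x) dotBr. Qed.

Lemma dot0l x : dot 0 x = 0.
Proof. by rewrite dotC dot0r. Qed.

Lemma dot_sumr (I : Type) (s : seq I) (P : pred I) (F : I -> 'rV[R]_d) x :
  dot x (\sum_(i <- s | P i) F i) = \sum_(i <- s | P i) dot x (F i).
Proof. by elim/big_rec2: _ => [|i y1 y2 _ <-]; rewrite ?dot0r ?dotDr. Qed.

Lemma dot_suml (I : Type) (s : seq I) (P : pred I) (F : I -> 'rV[R]_d) x :
  dot (\sum_(i <- s | P i) F i) x = \sum_(i <- s | P i) dot (F i) x.
Proof. by rewrite dotC dot_sumr; apply: eq_bigr => i _; rewrite dotC. Qed.

Lemma dot_delta x j : dot x (delta_mx ord0 j) = x ord0 j.
Proof.
rewrite /dot (bigD1 j) //= mxE !eqxx mulr1 big1 ?addr0 // => i neq_ij.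
by rewrite mxE (negPf neq_ij) andbF mulr0.
Qed.

Lemma dot_ge0 x : 0 <= dot x x.
Proof. by apply: sumr_ge0 => j _; rewrite -expr2 sqr_ge0. Qed.

Lemma dot_eq0 x : dot x x = 0 -> x = 0.
Proof.
move/eqP; rewrite psumr_eq0 => [/allP x0|j _]; last by rewrite -expr2 sqr_ge0.
apply/rowP => j; rewrite mxE; apply/eqP; rewrite -sqrf_eq0 expr2.
by have := x0 j; rewrite mem_index_enum => /(_ isT).
Qed.

Lemma enormE x : enorm x = Num.sqrt (dot x x).
Proof. by congr Num.sqrt; apply: eq_bigr => j _; rewrite expr2. Qed.

Lemma enorm0 : enorm (0 : 'rV[R]_d) = 0.
Proof. by rewrite enormE dot0r sqrtr0. Qed.

Lemma enorm_le_sqrt c x y : 0 <= c ->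
  dot x x <= c ^+ 2 * dot y y -> enorm x <= c * enorm y.
Proof.
move=> c0 le_xy; rewrite !enormE -[c in leRHS]ger0_norm // -sqrtr_sqr -sqrtrM ?sqr_ge0 //.
exact: ler_wsqrtr.
Qed.

Lemma is_derive_dot a x v : is_derive x v (dot a) (dot a v).
Proof.
have cvg_dot : (fun h : R => h^-1 *: ((dot a \o shift x) (h *: v) - dot a x)) @ 0^'
    --> dot a v.
  apply: cvg_near_cst; near=> h.
  have h0 : h != 0 by near: h; exact: nbhs_dnbhs_neq.
  by rewrite /= dotDr dotZr addrK scalerA mulVf // scale1r.
by apply: DeriveDef; [apply/cvg_ex; exists (dot a v)|apply: cvg_lim].
Unshelve. all: by end_near. Qed.

Lemma differentiable_dot a x : differentiable (dot a) x.
Proof.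
have -> : dot a = \sum_(j < d) (a ord0 j *: (fun y : 'rV[R]_d => y ord0 j)).
  by apply/funext => y; rewrite fct_sumE.
by apply: differentiable_sum => j; apply/differentiableZ/differentiable_coord.
Qed.

Lemma gradient_dot a x : gradient (dot a) x = a.
Proof.
by apply/rowP => j; rewrite mxE (@derive_val _ _ _ _ _ _ _ (is_derive_dot _ _ _)) dot_delta.
Qed.

Lemma convex_dot Q a : convex_function Q (dot a).
Proof.
move=> l x y _ _; rewrite convRE.
have -> : conv l x y = l%:num *: (x : 'rV[R]_d) + (1 - l%:num) *: (y : 'rV[R]_d) by [].
by rewrite dotDr !dotZr.
Qed.

Definition sqsum m (k : R) (w : nat -> 'rV[R]_d) (b : nat -> R) x : R :=
  k * \sum_(j < m) (dot (w j) x + b j) ^+ 2.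

Section SumOfSquares.
Variables (m : nat) (k : R) (w : nat -> 'rV[R]_d) (b : nat -> R).

Let sqsum_fctE :
  sqsum m k w b = k *: \sum_(j < m) (dot (w j) + cst (b j)) ^+ 2.
Proof. by apply/funext => y; rewrite /sqsum /= !fct_sumE. Qed.

Lemma differentiable_sqsum x : differentiable (sqsum m k w b) x.
Proof.
rewrite sqsum_fctE; apply/differentiableZ/differentiable_sum => j.
by apply/differentiableX/differentiableD => //; apply: differentiable_dot.
Qed.

Lemma gradient_sqsum x :
  gradient (sqsum m k w b) x =
  (2 * k) *: \sum_(j < m) (dot (w j) x + b j) *: w j.
Proof.
apply/rowP => i; rewrite mxE -[RHS]dot_delta dotZl dot_suml.
have der (j : 'I_m) := is_deriveX 2 (is_deriveD
  (is_derive_dot (w j) x (delta_mx ord0 i))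
  (is_derive_cst (b j) x (delta_mx ord0 i))).
rewrite sqsum_fctE (@derive_val _ _ _ _ _ _ _ (is_deriveZ k (is_derive_sum der))).
rewrite [RHS]mulrAC [RHS]mulrC big_distrr /=; congr (_ *: _).
apply: eq_bigr => j _; rewrite dotZl addr0 expr1 /=.
by rewrite mulrA.
Qed.

Lemma sqsum_ge0 x : 0 <= k -> 0 <= sqsum m k w b x.
Proof. by move=> k0; rewrite mulr_ge0 // sumr_ge0 // => j _; rewrite sqr_ge0. Qed.

Lemma convex_sqsum Q : 0 <= k -> convex_function Q (sqsum m k w b).
Proof.
move=> k0 t x y _ _; rewrite convRE.
have t0 : 0 <= t%:num by [].
have t1 : 0 <= 1 - t%:num by rewrite subr_ge0.
have -> : conv t x y = t%:num *: (x : 'rV[R]_d) + (1 - t%:num) *: (y : 'rV[R]_d) by [].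
rewrite /unstable.onem /sqsum !(mulrCA _ k) -mulrDr ler_wpM2l // !big_distrr -big_split /=.
apply: ler_sum => j _; rewrite dotDr !dotZr.
(* The convexity defect of a square is [t (1 - t)] times the squared difference of its two
   arguments. *)
have := mulr_ge0 (mulr_ge0 t0 t1) (sqr_ge0 (dot (w j) x - dot (w j) y)).
by rewrite -subr_ge0; congr (0 <= _); ring.
Qed.

End SumOfSquares.

End EuclideanSpace.

(** * The chain function *)

Section Chain.
Context {R : realType} {d : nat}.
Implicit Types (x y z : 'rV[R]_d) (v : nat -> 'rV[R]_d).

Definition orthonormal m v : Prop :=
  forall i j, (i < m)%N -> (j < m)%N -> dot (v i) (v j) = (i == j)%:R.

(** [s] is the orthogonal projection of [z] onto the span, so [<s, s> = <s, z>], and expanding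
    [|z - s|^2 >= 0] gives the bound. *)
Lemma bessel m v z : orthonormal m v ->
  \sum_(i < m) dot (v i) z ^+ 2 <= dot z z.
Proof.
move=> ov; pose s := \sum_(i < m) dot (v i) z *: v i.
have sz : dot s z = \sum_(i < m) dot (v i) z ^+ 2.
  by rewrite dot_suml; apply: eq_bigr => i _; rewrite dotZl expr2.
have ss : dot s s = dot s z.
  rewrite [LHS]dot_suml sz; apply: eq_bigr => i _.
  rewrite dotZl dot_sumr (bigD1 i) //= dotZr ov // eqxx mulr1 big1 ?addr0 ?expr2 //.
  by move=> j; rewrite -val_eqE eq_sym /= => /negPf ne; rewrite dotZr ov // ne mulr0.
rewrite -sz -subr_ge0; have := dot_ge0 (z - s).
by rewrite dotBl !dotBr ss (dotC z s) subrr subr0.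
Qed.

(** The matrix with columns [s] has fewer columns than rows, hence a nonzero left kernel vector,
    which is then normalized. *)
Lemma exists_unit_orthogonal (s : seq 'rV[R]_d) : (size s < d)%N ->
  exists2 u : 'rV[R]_d, dot u u = 1 & forall y, y \in s -> dot u y = 0.
Proof.
move=> lt_sd; pose M := \matrix_(i < d, j < size s) (nth 0 s j) ord0 i.
have /rowV0Pn[u /sub_kermxP uM u0] : kermx M != 0.
  by rewrite kermx_eq0 -row_leq_rank -ltnNge (leq_ltn_trans (rank_leq_col M)).
have uu : 0 < dot u u.
  by rewrite lt_def dot_ge0 andbT; apply: contra_neq u0; exact: dot_eq0.
exists ((Num.sqrt (dot u u))^-1 *: u) => [|y].
  rewrite dotZl dotZr mulrA -expr2 exprVn sqr_sqrtr ?dot_ge0 //.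
  by rewrite mulVf // gt_eqF.
move=> /(nthP 0)[j ltj <-]; rewrite dotZl.
have := congr1 (fun N : 'rV[R]__ => N ord0 (Ordinal ltj)) uM.
rewrite !mxE => uj; rewrite [X in _ * X](_ : _ = 0) ?mulr0 // -[RHS]uj.
by apply: eq_bigr => i _; rewrite !mxE.
Qed.

Definition chain_row v (j : nat) : 'rV[R]_d :=
  (if j is i.+1 then v i else 0) - v j.

Definition chain_offset (a : R) (j : nat) : R := if j is 0 then a else 0.

(* k ((a - <v_0, x>)^2 + sum_(0 < j < m) (<v_(j-1), x> - <v_j, x>)^2) *)
Definition chain m (k a : R) v : 'rV[R]_d -> R :=
  sqsum m k (chain_row v) (chain_offset a).

Lemma sum_chain_row m a v x :
  \sum_(j < m.+1) (dot (chain_row v j) x + chain_offset a j) = a - dot (v m) x.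
Proof.
elim: m => [|m IH]; first by rewrite big_ord1 /= dotBl dot0l; ring.
by rewrite big_ord_recr IH /= dotBl; ring.
Qed.

(** Cauchy-Schwarz, read off from the nonnegative sum of squared deviations from the mean. *)
Lemma sqr_sum_le m (F : nat -> R) :
  (\sum_(j < m.+1) F j) ^+ 2 / m.+1%:R <= \sum_(j < m.+1) F j ^+ 2.
Proof.
set s := \sum_(j < _) F j; set q := \sum_(j < _) _.
have m0 : m.+1%:R != 0 :> R by rewrite pnatr_eq0.
have : 0 <= \sum_(j < m.+1) (F j - s / m.+1%:R) ^+ 2.
  by apply: sumr_ge0 => j _; rewrite sqr_ge0.
rewrite (eq_bigr (fun j : 'I_m.+1 => (F j ^+ 2 + (- 2 * s / m.+1%:R) * F j)
  + (s / m.+1%:R) ^+ 2)) => [|j _]; last by field.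
rewrite !big_split /= -/q -big_distrr /= -/s sumr_const card_ord -mulr_natl.
by rewrite -[s ^+ 2 / _ <= _]subr_ge0; congr (0 <= _); field.
Qed.

Lemma chain_lower_bound m k a v x : 0 <= k -> dot (v m) x = 0 ->
  k * (a ^+ 2 / m.+1%:R) <= chain m.+1 k a v x.
Proof.
move=> k0 vx; rewrite ler_wpM2l //.
apply: le_trans (sqr_sum_le m (fun j => dot (chain_row v j) x + chain_offset a j)).
by rewrite sum_chain_row vx subr0.
Qed.

(** A row of index above [j] is a difference of two vectors orthogonal to [x], so only the rows up
    to [j], built from [v_0, ..., v_j], contribute. *)
Lemma gradient_chain_agree m k a v v' j x :
  (forall i, (i <= j)%N -> v i = v' i) ->
  (forall i, (j <= i < m)%N -> dot (v i) x = 0) ->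
  (forall i, (j <= i < m)%N -> dot (v' i) x = 0) ->
  gradient (chain m k a v) x = gradient (chain m k a v') x.
Proof.
move=> eqv vx v'x; rewrite !gradient_sqsum; congr (_ *: _).
apply: eq_bigr => -[[|i] /= ltim] _; first by rewrite /chain_row eqv.
have [le_ij|lt_ji] := leqP i.+1 j; first by rewrite /chain_row !eqv // ltnW.
have orth u : (forall i, (j <= i < m)%N -> dot (u i) x = 0) ->
    dot (chain_row u i.+1) x = 0.
  by move=> ux; rewrite dotBl !ux ?subr0 // ?(ltnW lt_ji) // -ltnS lt_ji ltnW.
by rewrite !orth // addr0 !scale0r.
Qed.

Lemma chain_row_sqnorm m v z : orthonormal m v ->
  \sum_(j < m) dot (chain_row v j) z ^+ 2 <= 4 * dot z z.
Proof.
move=> ov; have := bessel z ov; set b := \sum_(i < m) _ => bz.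
apply: le_trans (_ : 4 * b <= _); last by rewrite ler_pM2l.
apply: le_trans (_ : \sum_(j < m) (2 * dot (if nat_of_ord j is i.+1 then v i else 0) z ^+ 2
    + 2 * dot (v j) z ^+ 2) <= _).
  apply: ler_sum => j _; rewrite dotBl -subr_ge0.
  set p := dot _ z; set q := dot _ z.
  by rewrite (_ : _ - _ = (p + q) ^+ 2) ?sqr_ge0 //; ring.
rewrite big_split -!big_distrr /= -/b.
(* The shift by one index drops the last term of [b] and adds a zero term. *)
suff : \sum_(j < m) dot (if nat_of_ord j is i.+1 then v i else 0) z ^+ 2 <= b by lra.
rewrite /b; case: (m) => [|m']; first by rewrite !big_ord0.
rewrite big_ord_recl big_ord_recr /= dot0l expr0n add0r lerDl.
exact: sqr_ge0.
Qed.

(* With T the symmetric map [z |-> sum_j <w_j, z> w_j], the bound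
   [sum_j <w_j, z>^2 <= 4 |z|^2] applied at z and at T z gives [|T z| <= 4 |z|]. *)
Lemma chain_gradient_lipschitz m L a v x y : 0 <= L -> orthonormal m v ->
  enorm (gradient (chain m (L / 8) a v) x - gradient (chain m (L / 8) a v) y)
    <= L * enorm (x - y).
Proof.
move=> L0 ov; rewrite !gradient_sqsum -scalerBr -sumrB; set z := x - y.
rewrite (eq_bigr (fun j : 'I_m => dot (chain_row v j) z *: chain_row v j)); last first.
  by move=> j _; rewrite -scalerBl dotBr; congr (_ *: _); ring.
set T := \sum_(j < m) _; apply: enorm_le_sqrt => //.
rewrite dotZl dotZr.
suff T16 : dot T T <= 16 * dot z z.
  have -> q : 2 * (L / 8) * (2 * (L / 8) * q) = L ^+ 2 * (q / 16) :> R by field.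
  by rewrite ler_wpM2l ?sqr_ge0 // ler_pdivrMr // mulrC.
(* The weights in [p q <= 2 p^2 + q^2 / 8] turn the factor 4 of [chain_row_sqnorm] into
   [|T|^2 <= 8 |z|^2 + |T|^2 / 2]. *)
have TT : dot T T <= \sum_(j < m) (2 * dot (chain_row v j) z ^+ 2
    + 8^-1 * dot (chain_row v j) T ^+ 2).
  rewrite {1}/T dot_suml; apply: ler_sum => j _; rewrite dotZl -subr_ge0.
  set p := dot _ z; set q := dot _ T.
  have := sqr_ge0 (p - q / 4); nra.
move: TT; rewrite big_split -!big_distrr /=.
have := chain_row_sqnorm z ov; have := chain_row_sqnorm T ov; lra.
Qed.

(** Every square vanishes, and the value [a] then propagates from [v_0] along the chain. *)
Lemma chain_eq0 m k a v x : 0 < k -> chain m k a v x = 0 ->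
  forall j, (j < m)%N -> dot (v j) x = a.
Proof.
move=> k0 /eqP; rewrite mulf_eq0 gt_eqF //= psumr_eq0 => [/allP x0|i _]; last first.
  exact: sqr_ge0.
have c0 j : (j < m)%N -> dot (chain_row v j) x + chain_offset a j = 0.
  move=> ltj; apply/eqP; rewrite -sqrf_eq0.
  by have := x0 (Ordinal ltj); rewrite mem_index_enum => /(_ isT).
elim=> [|j IH] ltj.
  by have := c0 _ ltj; rewrite /= dotBl dot0l; lra.
by have := c0 _ ltj; rewrite /= dotBl IH ?(ltnW ltj) //; lra.
Qed.

Lemma chain_minimizer m k a v : 0 < k -> 0 < a -> orthonormal m v ->
  let xs := a *: \sum_(i < m) v i in
  [/\ chain m k a v xs = 0, is_minimizer setT (chain m k a v) xs
    & closest_minimizer_dist setT (chain m k a v) (Num.sqrt m%:R * a)].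
Proof.
move=> k0 a0 ov xs.
have vxs j : (j < m)%N -> dot (v j) xs = a.
  move=> ltj; rewrite dotZr dot_sumr (bigD1 (Ordinal ltj)) //= ov // eqxx.
  rewrite big1 ?addr0 ?mulr1 // => i; rewrite -val_eqE /= => /negPf ne.
  by rewrite ov // eq_sym ne.
have fxs : chain m k a v xs = 0.
  rewrite /chain /sqsum big1 ?mulr0 // => -[[|j] ltj] _ /=.
    by rewrite dotBl dot0l vxs //; ring.
  by rewrite dotBl !vxs ?(ltnW ltj) //; ring.
have mxs : is_minimizer setT (chain m k a v) xs.
  by split=> // y _; rewrite fxs sqsum_ge0 // ltW.
have xsx x : (forall j, (j < m)%N -> dot (v j) x = a) -> dot xs x = m%:R * a ^+ 2.
  move=> vx; rewrite dotZl dot_suml (eq_bigr (fun=> a)) => [|i _]; last exact: vx.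
  by rewrite sumr_const card_ord -mulr_natl; ring.
have normxs : enorm xs = Num.sqrt m%:R * a.
  by rewrite enormE (xsx _ vxs) sqrtrM ?ler0n // sqrtr_sqr ger0_norm // ltW.
split=> //; split; first by exists xs.
move=> x [_ /(_ xs I)]; rewrite fxs => fx.
have /chain_eq0-/(_ k0)vx : chain m k a v x = 0.
  by apply/eqP; rewrite eq_le fx sqsum_ge0 // ltW.
rewrite -normxs !enormE; apply: ler_wsqrtr.
(* [x - xs] is orthogonal to [xs], so [xs] is the shortest minimizer by Pythagoras. *)
have := dot_ge0 (x - xs); rewrite dotBl !dotBr (dotC x xs) (xsx _ vx) (xsx _ vxs).
lra.
Qed.

(* A resisting oracle: [pts G j] stands for the j-th point at which an
   algorithm that is answered by the map G learns a gradient. *)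
Lemma resisting_chain m k a (c : R) (pts : ('rV[R]_d -> 'rV[R]_d) -> nat -> 'rV[R]_d) :
  (2 * m < d)%N ->
  (forall G G' j, (j < m)%N ->
     (forall i, (i < j)%N -> G (pts G i) = G' (pts G i)) -> pts G j = pts G' j) ->
  exists2 v, orthonormal m v &
    forall i j, (j <= i < m)%N ->
      dot (v i) (pts (fun x => c *: gradient (chain m k a v) x) j) = 0.
Proof.
move=> lt_md causal.
pose grad v x := c *: gradient (chain m k a v) x.
suff [v [ov _ vp]] : exists v, [/\ orthonormal m v, forall i, (m <= i)%N -> v i = 0
    & forall i j, (j <= i < m)%N -> dot (v i) (pts (grad v) j) = 0] by exists v.
(* The family is built one vector at a time. Vectors not built yet are 0, hence orthogonal to every
   point. *)
suff : forall q, (q <= m)%N -> exists v,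
    [/\ orthonormal q v, forall i, (q <= i)%N -> v i = 0
      & forall i j, (j <= i < q)%N -> dot (v i) (pts (grad v) j) = 0].
  exact.
elim=> [|q IH] ltqm; first by exists (fun=> 0); split=> // i j; rewrite ltn0 andbF.
have [v [ov v0 vp]] := IH (ltnW ltqm).
(* These are [2 q + 1 < d] vectors. Point [q] is among them, since the vectors before [v_q] already
   determine it. *)
pose s := mkseq v q ++ mkseq (pts (grad v)) q.+1.
have [|u uu us] := @exists_unit_orthogonal s.
  by rewrite size_cat !size_mkseq (leq_ltn_trans _ lt_md) //; lia.
have uv i : (i < q)%N -> dot u (v i) = 0.
  by move=> lti; apply: us; rewrite mem_cat map_f ?mem_iota.
have up j : (j <= q)%N -> dot u (pts (grad v) j) = 0.
  by move=> lej; apply: us; rewrite mem_cat orbC map_f ?mem_iota.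
pose v' i := if i == q then u else v i.
have v'E i : (i < q)%N -> v' i = v i by rewrite /v'; case: ltngtP.
have v'p i j : (j <= i <= q)%N -> dot (v' i) (pts (grad v) j) = 0.
  case/andP=> le_ji; rewrite /v' leq_eqVlt; case: eqP => [ei _|_ /= lti].
    by apply: up; rewrite -ei.
  by apply: vp; rewrite le_ji.
(* Replacing [v_q] by [u] moves none of the points up to [q]: the answer at an earlier point [i < q]
   only involves [v_0, ..., v_i]. *)
have eqp j : (j <= q)%N -> pts (grad v) j = pts (grad v') j.
  move=> lej; apply: causal => [|i lti]; first exact: leq_ltn_trans ltqm.
  have ltiq := leq_trans lti lej.
  rewrite /grad; congr (_ *: _).
  apply: (@gradient_chain_agree m k a v v' i) => [l lel|l|l].
  - by rewrite v'E // (leq_ltn_trans lel).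
  - case/andP=> leil ltlm; have [ltlq|leql] := ltnP l q; first by rewrite vp ?leil.
    by rewrite v0 // dot0l.
  - case/andP=> leil ltlm; have [lelq|ltql] := leqP l q; first by rewrite v'p ?leil.
    by rewrite /v' gtn_eqF // v0 ?dot0l // ltnW.
exists v'; split=> [i j|i lti|i j].
- rewrite !ltnS /v'; case: (eqVneq i q) => [-> _|nei].
    case: (eqVneq j q) => [-> _|nej]; first by rewrite uu.
    by rewrite leq_eqVlt (negPf nej) => ltj; rewrite uv.
  rewrite leq_eqVlt (negPf nei) /= => lti.
  case: (eqVneq j q) => [-> _|nej]; first by rewrite dotC uv // (negPf nei).
  by rewrite leq_eqVlt (negPf nej) => ltj; rewrite ov.
- by rewrite /v' gtn_eqF // v0 // ltnW.
- case/andP=> leji; rewrite ltnS => leiq.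
  by rewrite -eqp ?v'p ?leji // (leq_trans leji).
Qed.

End Chain.

(** * Noiseless instance *)

Section HardInstance.
Context {R : realType} {n : nat}.

(** The conclusion of the theorem, isolated so that either instance can provide it. *)
Definition hard_instance (sigma2 : R) (tau : 'I_n.+1 -> R) (r L eps t : R)
    (A : forall d : nat, set 'rV[R]_d -> algorithm R n d) : Prop :=
  exists (d : nat) (Q : set 'rV[R]_d) (f : 'rV[R]_d -> R)
         (dS : measure_display) (S : measurableType dS)
         (O : 'I_n.+1 -> oracle R d S) (D : 'I_n.+1 -> probability S R),
    [/\ convex_set Q /\ Q 0,
        smooth_convex_class Q L f,
        closest_minimizer_dist Q f r,
        oracle_class Q tau sigma2 f O D
      & forall (dO : measure_display) (Om : measurableType dO)
               (P : probability Om R) (xi : nat * 'I_n.+1 -> Om -> S),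
          independent_samples P D xi ->
          let F := fun w : Om =>
            let xiw := fun k i => xi (k, i) w in
            f (iterate (A d Q) O xiw (last_index (A d Q) O xiw t)) in
          measurable_fun [set: Om] F /\
          (eps%:E < 'E_P[F] - (inf (f @` Q))%:E)%E].

Lemma inf_minimizer d (Q : set 'rV[R]_d) f x :
  is_minimizer Q f x -> inf (f @` Q) = f x.
Proof.
move=> [Qx fx]; apply/le_anti/andP; split.
  by apply: ge_inf; [exists (f x) => _ [y Qy <-]; apply: fx|exists x].
by apply: lb_le_inf; [exists (f x), x|move=> _ [y Qy <-]; apply: fx].
Qed.

End HardInstance.

Section Noiseless.
Context {R : realType} {n d : nat}.
Variables (A : algorithm R n d) (Q : set 'rV[R]_d).
Hypothesis admA : admissible_algorithm Q A.
Variables (tau : 'I_n.+1 -> R) (tau0 : forall i, 0 < tau i).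
Variables (t : R) (t0 : 0 <= t).

Definition last_worker_only (G : 'rV[R]_d -> 'rV[R]_d) :
    'I_n.+1 -> 'rV[R]_d -> bool -> 'rV[R]_d :=
  fun i x _ => if i == ord_max then G x else 0.

Local Notation xi0 := (fun _ _ => false).
Local Notation lrun G := (drun A tau (last_worker_only G) xi0).
Local Notation lcount G := (nresponses A tau (last_worker_only G) xi0 ord_max).
Local Notation llast G :=
  (last_index A (fun i => delayed_oracle (tau i) (last_worker_only G i)) xi0 t).

(** [j] counts the responses of the slowest worker before step [k], so [x] is the point of its
    response number [j + 1]. *)
Definition learned_points (G : 'rV[R]_d -> 'rV[R]_d) (j : nat) : set 'rV[R]_d :=
  [set x | exists k, [/\ responds A tau (lrun G k), turn A (lrun G k) = ord_max,
                         lcount G k = j & x = asked A (lrun G k)]].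

Definition learned_point G j : 'rV[R]_d := xget 0 (learned_points G j).

Lemma lcount_respond G k l :
  responds A tau (lrun G k) -> turn A (lrun G k) = ord_max ->
  (k < l)%N -> (lcount G k < lcount G l)%N.
Proof.
move=> resp last ltkl; have := leq_nresponses A tau (last_worker_only G) xi0 ord_max ltkl.
by rewrite nresponsesS resp last eqxx addn1.
Qed.

(** The count jumps at each response of this worker, so no two responses share an index and the
    point picked by [xget] comes from this step. *)
Lemma learned_pointE G k :
  responds A tau (lrun G k) -> turn A (lrun G k) = ord_max ->
  learned_point G (lcount G k) = asked A (lrun G k).
Proof.
move=> resp last; rewrite /learned_point; case: xgetP; last first.
  by move/(_ (asked A (lrun G k))); case; exists k.
move=> _ _ [l [respl lastl eqc ->]]; congr (asked A (lrun G _)).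
apply/eqP; rewrite eqn_leq; apply/andP; split; rewrite leqNgt; apply/negP.
  by move=> /(lcount_respond resp last); rewrite eqc ltnn.
by move=> /(lcount_respond respl lastl); rewrite eqc ltnn.
Qed.

(** The responses of the slowest worker before step [K] have indices below [j], where the two maps
    agree; all other workers answer 0 under both. *)
Lemma lrun_agree G G' j K :
  (forall i, (i < j)%N -> G (learned_point G i) = G' (learned_point G i)) ->
  (lcount G K <= j)%N -> lrun G K = lrun G' K /\ lcount G K = lcount G' K.
Proof.
move=> agree; have runE k : (lcount G k <= j)%N -> lrun G k = lrun G' k.
  move=> lek; apply: drun_agree => l ltl resp; rewrite /last_worker_only.
  case: eqP => // last; rewrite -learned_pointE //; apply: agree.
  exact: leq_trans (lcount_respond resp last ltl) lek.
move=> leK; split; first exact: runE.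
apply: eq_bigr => k _; rewrite runE //; apply: leq_trans leK.
exact/leq_nresponses/ltnW.
Qed.

Lemma learned_points_sub G G' j :
  (forall i, (i < j)%N -> G (learned_point G i) = G' (learned_point G i)) ->
  learned_points G j `<=` learned_points G' j.
Proof.
move=> agree x [k [resp last eqc ->]]; exists k.
by have [<- <-] := lrun_agree agree (eq_leq eqc).
Qed.

Lemma learned_point_agree G G' j :
  (forall i, (i < j)%N -> G (learned_point G i) = G' (learned_point G i)) ->
  learned_point G j = learned_point G' j.
Proof.
elim/ltn_ind: j => j IH agree; congr (xget 0 _); apply/seteqP; split.
  exact: learned_points_sub.
(* This inclusion needs agreement at the points of [G'], which by induction are those of [G]. *)
apply: learned_points_sub => i lti; rewrite -IH => [|//|l ltl]; first by rewrite agree.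
by apply: agree; apply: ltn_trans lti.
Qed.

Lemma lcount_last G m : t < tau ord_max * m.+1%:R -> (lcount G (llast G) <= m)%N.
Proof.
move=> lt_tm; rewrite -ltnS -(ltr_nat R) -(ltr_pM2l (tau0 ord_max)).
apply: le_lt_trans lt_tm; apply: le_trans (nresponses_time admA _ _ _ (ltW (tau0 _))) _.
by have /andP[] := last_indexP admA
  (fun i => delayed_oracle (tau i) (last_worker_only G i)) xi0 t0.
Qed.

(** Index [m] stands for the output, so that the last vector of the chain is made orthogonal to
    it. *)
Definition resisted_point m G j : 'rV[R]_d :=
  if (j < m)%N then learned_point G j else qpoint (A (lrun G (llast G)).1).

(** For [j = m], at most [m] gradients are learned before time [t], so the answers at the first [m]
    points fix the run up to the output. *)
Lemma resisted_point_causal m G G' j : t < tau ord_max * m.+1%:R -> (j < m.+1)%N ->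
  (forall i, (i < j)%N -> G (resisted_point m G i) = G' (resisted_point m G i)) ->
  resisted_point m G j = resisted_point m G' j.
Proof.
move=> lt_tm; rewrite ltnS => lejm agree.
have {}agree i : (i < j)%N -> G (learned_point G i) = G' (learned_point G i).
  by move=> lti; have := agree i lti; rewrite /resisted_point (leq_trans lti).
rewrite /resisted_point; case: ltnP => [_|le_mj]; first exact: learned_point_agree.
have {lejm le_mj} ej : j = m by apply/eqP; rewrite eqn_leq lejm.
rewrite ej in agree.
have [runE _] := lrun_agree agree (lcount_last G lt_tm).
by rewrite (last_index_run admA t0 runE) runE.
Qed.

End Noiseless.

Lemma noiseless_hard_instance (R : realType) (n : nat) (sigma2 : R)
    (tau : 'I_n.+1 -> R) (r L eps t : R)
    (A : forall d : nat, set 'rV[R]_d -> algorithm R n d) (m : nat) :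
  0 <= sigma2 -> (forall i, 0 < tau i) -> 0 < r -> 0 < L -> 0 <= t -> zr_class A ->
  t < tau ord_max * m.+1%:R -> eps < L / 8 * (r ^+ 2 / m.+1%:R ^+ 2) ->
  hard_instance sigma2 tau r L eps t A.
Proof.
move=> sigma0 tau0 r0 L0 t0 zrA lt_tm lt_eps.
(* Room for a vector orthogonal to [m + 1] points and to the other chain vectors. *)
pose d := (2 * m.+1).+1; pose Q : set 'rV[R]_d := setT.
have cQ : convex_set Q by move=> x y l _ _; rewrite inE.
have admA : admissible_algorithm Q (A d Q) by apply: zrA => //; exists 0.
have m0 : 0 < Num.sqrt (m.+1%:R : R) by rewrite sqrtr_gt0.
(* Places the closest minimizer, of norm [sqrt (m + 1) a], at distance [r]. *)
pose a := r / Num.sqrt m.+1%:R; have a0 : 0 < a by rewrite divr_gt0.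
have k0 : 0 < L / 8 by rewrite divr_gt0.
have [|v ov vp] := resisting_chain (L / 8) a n.+1%:R (ltnSn (2 * m.+1))
    (pts := resisted_point (A d Q) tau t m).
  by move=> G G' j ltj; exact: (resisted_point_causal admA tau0 t0 lt_tm ltj).
set f := chain m.+1 (L / 8) a v in vp *.
have [fxs mxs closest] := chain_minimizer k0 a0 ov; set xs := a *: _ in fxs mxs.
(* The factor [n + 1] cancels the averaging over the workers. *)
pose fi (i : 'I_n.+1) := if i == ord_max then chain m.+1 (n.+1%:R * (L / 8)) a v else cst 0.
pose G i x (b : bool) := gradient (fi i) x.
have GE : G = last_worker_only (fun x => n.+1%:R *: gradient f x).
  apply/funext => i; apply/funext => x; apply/funext => b.
  rewrite /G /fi /last_worker_only; case: eqP => _.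
    by rewrite !gradient_sqsum scalerA mulrCA.
  by apply/rowP => j; rewrite !mxE derive_cst.
exists d, Q, f, _, bool, (fun i => delayed_oracle (tau i) (G i)), (fun=> bernoulli_prob 0).
split => //.
- split=> [|x _|x y _ _].
  + exact/convex_sqsum/ltW.
  + exact: differentiable_sqsum.
  + exact: (chain_gradient_lipschitz _ _ _ (ltW L0) ov).
- by have <- : Num.sqrt m.+1%:R * a = r by rewrite mulrC divfK ?gt_eqF.
- exists fi, G; split=> //.
  + move=> x; rewrite (bigD1 ord_max) //= /fi eqxx big1 => [|i /negPf -> //].
    by rewrite addr0 [RHS]mulrA mulKf ?pnatr_eq0.
  + move=> i x _; rewrite /fi; case: eqP => _; last exact: differentiable_cst.
    exact: differentiable_sqsum.
  + move=> i x _ j; split; last by rewrite /G expectation_cst.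
    exact: finite_measure_integrable_cst.
  + move=> i x _; rewrite /G; under eq_fun do rewrite subrr enorm0 expr0n /=.
    by rewrite expectation_cst lee_fin.
- move=> dO Om P xi _ /=.
  (* [G] ignores its sample, so the output is deterministic. *)
  pose out := qpoint (A d Q (drun (A d Q) tau G (fun _ _ => false)
    (last_index (A d Q) (fun i => delayed_oracle (tau i) (G i)) (fun _ _ => false) t)).1).
  have -> : (fun w : Om => f (iterate (A d Q) (fun i => delayed_oracle (tau i) (G i))
      (fun k i => xi (k, i) w) (last_index (A d Q) (fun i => delayed_oracle (tau i) (G i))
      (fun k i => xi (k, i) w) t))) = cst (f out).
    by apply/funext => w; congr f.
  split; first exact: measurable_cst.
  rewrite expectation_cst (inf_minimizer mxs) fxs sube0 lte_fin.
  apply: lt_le_trans lt_eps _.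
  have -> : r ^+ 2 / m.+1%:R ^+ 2 = a ^+ 2 / m.+1%:R.
    by rewrite /a exprMn exprVn sqr_sqrtr ?ler0n // [m.+1%:R ^+ 2]expr2 invfM mulrA.
  apply: chain_lower_bound; first exact: ltW.
  by have := vp m m; rewrite leqnn ltnSn /resisted_point ltnn -GE; apply.
Qed.

(** * Sparse noise *)

Section Expectation.

Lemma bounded_integrable (dT : measure_display) (T : measurableType dT)
    (R : realType) (P : probability T R) (f : T -> R) (c : R) :
  measurable_fun setT f -> (forall x, `|f x| <= c) ->
  P.-integrable setT (EFin \o f).
Proof.
move=> mf fc; apply: measurable_bounded_integrable => //.
  by apply: le_lt_trans (probability_le1 P measurableT) _; rewrite ltry.
exists c; split; first exact: num_real.
by move=> M ltM x _; apply: le_trans (fc x) (ltW ltM).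
Qed.

(** [f] dominates [- c] times the indicator of [B]. *)
Lemma expectation_ge_bad_event (dT : measure_display) (T : measurableType dT)
    (R : realType) (P : probability T R) (f : T -> R) (B : set T) (c q : R) :
  measurable_fun setT f -> measurable B -> 0 <= c -> (forall x, `|f x| <= c) ->
  (forall x, ~ B x -> 0 <= f x) -> (P B <= q%:E)%E ->
  ((- (c * q))%:E <= 'E_P[f])%E.
Proof.
move=> mf mB c0 fc f0 PB.
have indic_int : P.-integrable setT (EFin \o (\1_B : T -> R)).
  apply: (@bounded_integrable _ _ _ _ _ 1) => [|x].
    exact/measurable_realfun.measurable_indicP.
  by rewrite indicE ger0_norm ?ler0n // lern1 leq_b1.
have indic_L : (\1_B : T -> R) \in Lfun P 1 by apply/Lfun1_integrable.
apply: le_trans (_ : 'E_P[(- c) \o* (\1_B : T -> R)] <= _)%E.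
  rewrite expectationZl // expectation_indic // !EFinN mulNe leeN2 EFinM.
  by apply: lee_wpmul2l; rewrite ?lee_fin.
rewrite unlock; apply: le_integral => //.
- by apply/Lfun1_integrable; exact: Lfun_scale.
- exact: bounded_integrable fc.
- move=> x _; rewrite lee_fin /= indicE; case: (asboolP (B x)) => Bx.
    by rewrite mem_set // mul1r; have := fc x; rewrite ler_norml => /andP[].
  by rewrite memNset // mul0r f0.
Qed.

Lemma bernoulli_integrable (R : realType) (p : R) (f : bool -> R) :
  (bernoulli_prob p).-integrable setT (EFin \o f).
Proof.
apply: (@bounded_integrable _ _ _ _ _ (`|f true| + `|f false|)) => // -[].
  by rewrite lerDl.
by rewrite lerDr.
Qed.

Lemma expectation_bernoulli (R : realType) (p c : R) : 0 <= p <= 1 ->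
  'E_(bernoulli_prob p)[fun b => if b then c else 0%R]%E = (p * c)%:E.
Proof.
move=> p01.
have -> : (fun b : bool => if b then c else 0) = c \o* (fun b : bool => b%:R : R).
  by apply/funext => -[]; rewrite /= ?mul1r ?mul0r.
rewrite expectationZl; last exact/Lfun1_integrable/bernoulli_integrable.
rewrite unlock integral_bernoulli_prob //.
by rewrite /= mule1 mule0 adde0 -EFinM mulrC.
Qed.

End Expectation.

(** * Runs whose answers are rarely nonzero *)

Section NoisyRun.
Context {R : realType} {n d : nat}.
Variables (A : algorithm R n d) (Q : set 'rV[R]_d).
Hypothesis admA : admissible_algorithm Q A.
Variables (tau : 'I_n.+1 -> R) (G : 'I_n.+1 -> 'rV[R]_d -> bool -> 'rV[R]_d).
Variables (t : R) (t0 : 0 <= t).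
Context (dO : measure_display) (Om : measurableType dO).
Variable xi : nat * 'I_n.+1 -> Om -> bool.
Hypothesis mxi : forall p, measurable_fun [set: Om] (xi p).

Local Notation xiw w := (fun k i => xi (k, i) w).
Local Notation O := (fun i => delayed_oracle (tau i) (G i)).

Lemma measurable_sample p b : measurable [set w | xi p w = b].
Proof. by have := mxi p measurableT (Y := [set b]); rewrite setTI; apply. Qed.

(** Arbitrary sets [Y] are allowed because each step splits the event into finitely many cases: the
    worker in turn and its boolean sample. *)
Lemma measurable_drun k (Y : set (seq 'rV[R]_d * ('I_n.+1 -> oracle_state R d))) :
  measurable [set w | Y (drun A tau G (xiw w) k)].
Proof.
elim: k Y => [|k IH] Y.
  have [Y0|nY0] := pselect (Y ([::], fun=> OracleState 0 0 false)).
    by rewrite [X in measurable X](_ : _ = setT) //; apply/seteqP; split.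
  by rewrite [X in measurable X](_ : _ = set0) //; apply/seteqP; split.
pose Z i b : set (seq 'rV[R]_d * ('I_n.+1 -> oracle_state R d)) :=
  [set p | turn A p = i /\ Y (rcons p.1 (if responds A tau p then G i (asked A p) b
                                          else 0), next_states A tau p)].
rewrite [X in measurable X](_ : _ = \bigcup_(ib : 'I_n.+1 * bool)
    ([set w | Z ib.1 ib.2 (drun A tau G (xiw w) k)] `&`
     [set w | xi (k, ib.1) w = ib.2])); last first.
  apply/seteqP; split => w.
    rewrite /mkset drunS => Yw.
    by exists (turn A (drun A tau G (xiw w) k),
      xi (k, turn A (drun A tau G (xiw w) k)) w).
  move=> [[i b] _ [[ei Yw] xib]]; rewrite /mkset drunS.
  by move: Yw; rewrite -xib -ei.
apply: fin_bigcup_measurable => // ib _.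
by apply: measurableI => //; apply: measurable_sample.
Qed.

(** The event is cut by the value [k] of the last index into countably many pieces, each described
    by runs of at most [k] steps. *)
Lemma measurable_final (f : 'rV[R]_d -> R) :
  measurable_fun [set: Om]
    (fun w => f (iterate A O (xiw w) (last_index A O (xiw w) t))).
Proof.
move=> _ B mB; rewrite setTI.
rewrite [X in measurable X](_ : _ = \bigcup_k
    ([set w | iter_time A O (xiw w) k <= t] `&`
     [set w | t < qtime (A (drun A tau G (xiw w) k).1) /\
              B (f (qpoint (A (drun A tau G (xiw w) k).1)))])); last first.
  apply/seteqP; split => w.
    have /andP[le_t lt_t] := last_indexP admA O (xiw w) t0.
    by move=> Bw; exists (last_index A O (xiw w) t).
  move=> [k _ [/= le_t [lt_t Bk]]].
  by rewrite /preimage /= (last_index_eq admA le_t lt_t).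
apply: bigcupT_measurable => k; apply: measurableI; last first.
  exact: (measurable_drun k [set p | t < qtime (A p.1) /\ B (f (qpoint (A p.1)))]).
case: k => [|k]; last exact: (measurable_drun k [set p | qtime (A p.1) <= t]).
by rewrite [X in measurable X](_ : _ = setT) //; apply/seteqP; split.
Qed.

Variable D : 'I_n.+1 -> probability bool R.
Variable P : probability Om R.
Hypothesis xiD : forall p (B : set bool), measurable B -> P (xi p @^-1` B) = D p.2 B.
Variable (p : 'I_n.+1 -> R).
Hypothesis Dp : forall i, D i [set true] = (p i)%:E.
Hypothesis p0 : forall i, 0 <= p i.
Hypothesis tau0 : forall i, 0 < tau i.

Local Notation silent := (fun _ _ => false).
Local Notation last0 := (last_index A O silent t).

(** Defined along the silent run, whose steps and workers are deterministic, so that a union bound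
    applies. *)
Definition nonzero_answer : set Om :=
  \bigcup_(k < last0) (if responds A tau (drun A tau G silent k) then
    [set w | xi (k, turn A (drun A tau G silent k)) w = true] else set0).

Let meas_resp k : measurable (if responds A tau (drun A tau G silent k) then
    [set w | xi (k, turn A (drun A tau G silent k)) w = true] else set0).
Proof. by case: ifP => // _; apply: measurable_sample. Qed.

Lemma measurable_nonzero_answer : measurable nonzero_answer.
Proof. exact: bigcup_measurable. Qed.

Lemma silent_run w : ~ nonzero_answer w ->
  iterate A O (xiw w) (last_index A O (xiw w) t) = iterate A O silent last0.
Proof.
move=> nbad.
have runE : drun A tau G silent last0 = drun A tau G (xiw w) last0.
  apply: drun_agree => k ltk resp; congr (G _ _ _); apply/esym/negP => xit.
  by apply: nbad; exists k => //; rewrite resp.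
by rewrite (last_index_run admA t0 runE) /iterate -[run _ _ _ _]runE.
Qed.

(** In the union bound over the steps, worker [i] contributes [p i] per response, and it responds at
    most [t / tau i] times. *)
Lemma probability_nonzero_answer :
  (P nonzero_answer <= (\sum_(i < n.+1) t / tau i * p i)%:E)%E.
Proof.
rewrite /nonzero_answer bigcup_mkord.
apply: le_trans (Boole_inequality P (fun i _ => meas_resp i)) _.
apply: le_trans (_ : (\sum_(k < last0) \sum_(i < n.+1)
    (responds A tau (drun A tau G silent k) &&
      (turn A (drun A tau G silent k) == i))%:R * p i)%:E <= _)%E; last first.
  rewrite lee_fin exchange_big /=; apply: ler_sum => i _.
  rewrite -big_distrl /= ler_wpM2r // ler_pdivlMr // mulrC.
  rewrite -natr_sum; apply: le_trans (nresponses_time admA G silent _ (ltW (tau0 i))) _.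
  by have /andP[] := last_indexP admA O silent t0.
rewrite -sumEFin; apply: lee_sum => k _.
set pk := drun A tau G silent k; rewrite (bigD1 (turn A pk)) //= eqxx andbT.
rewrite [X in (_ + X)%R]big1 ?addr0 => [|i /negPf ni]; last first.
  by rewrite eq_sym ni andbF mul0r.
case: ifP => _; last by rewrite measure0 mul0r.
by rewrite mul1r -Dp -(xiD (k : nat, turn A pk)).
Qed.

End NoisyRun.

(** * Linear functions on a segment of the line *)

Section Interval.
Context {R : realType}.
Implicit Types (x y : 'rV[R]_1) (r s g : R).

Lemma dot_dim1 x y : dot x y = x ord0 ord0 * y ord0 ord0.
Proof. by rewrite /dot big_ord1. Qed.

Lemma enorm_dim1 x : enorm x = `|x ord0 ord0|.
Proof. by rewrite enormE dot_dim1 -expr2 sqrtr_sqr. Qed.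

Definition segment r : set 'rV[R]_1 := [set x | `|x ord0 ord0| <= r].

Lemma convex_segment r : convex_set (segment r).
Proof.
move=> x y l; rewrite !inE /segment /= => xr yr.
have l0 : 0 <= l%:num by [].
have l1 : 0 <= 1 - l%:num by rewrite subr_ge0.
rewrite [conv l x y ord0 ord0](_ : _ =
  l%:num * x ord0 ord0 + (1 - l%:num) * y ord0 ord0); last by rewrite !mxE.
apply: le_trans (ler_normD _ _) _; rewrite !normrM (ger0_norm l0) (ger0_norm l1).
have := ler_wpM2l l0 xr; have := ler_wpM2l l1 yr; lra.
Qed.

Lemma segment_minimizer r g s : 0 < r -> 0 < g -> s ^+ 2 = 1 ->
  let f := dot (const_mx (s * g) : 'rV[R]_1) in
  let xs := const_mx (- (s * r)) in
  [/\ f xs = - (g * r), is_minimizer (segment r) f xs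
    & closest_minimizer_dist (segment r) f r].
Proof.
move=> r0 g0 s1 f xs.
have fE x : f x = g * (s * x ord0 ord0) by rewrite /f dot_dim1 mxE; ring.
have s1n : `|s| = 1.
  by apply/eqP; rewrite -sqr_norm_eq1 s1.
have fxs : f xs = - (g * r).
  by rewrite fE mxE mulrN mulrA -expr2 s1 mul1r mulrN.
have normxs : `|xs ord0 ord0| = r by rewrite mxE normrN normrM s1n mul1r gtr0_norm.
have sx x : segment r x -> `|s * x ord0 ord0| <= r by rewrite normrM s1n mul1r.
have mxs : is_minimizer (segment r) f xs.
  split=> [|x /sx]; first by rewrite /segment /= normxs.
  rewrite ler_norml fxs fE -mulrN => /andP[le_x _].
  by rewrite ler_pM2l.
split=> //; split; first by exists xs; rewrite ?enorm_dim1.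
move=> x [/sx Qx /(_ xs)]; rewrite fxs fE enorm_dim1 -mulrN ler_pM2l // => fx.
have {}fx := fx (proj1 mxs).
rewrite -[`|x _ _|]mul1r -s1n -normrM -normrN.
by apply: le_trans (ler_norm _); rewrite lerNr.
Qed.

End Interval.

Lemma noisy_hard_instance (R : realType) (n : nat) (sigma2 : R)
    (tau : 'I_n.+1 -> R) (r L eps t : R)
    (A : forall d : nat, set 'rV[R]_d -> algorithm R n d) :
  0 < sigma2 -> (forall i, 0 < tau i) -> 0 < r -> 0 < L -> 0 < eps -> 0 <= t ->
  zr_class A ->
  t <= 32^-1 * ((n.+1%:R^-1 * \sum_(i < n.+1) tau i)
                 * (sigma2 * r ^+ 2 / (n.+1%:R * eps ^+ 2))) ->
  hard_instance sigma2 tau r L eps t A.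
Proof.
move=> sigma0 tau0 r0 L0 eps0 t0 zrA le_t.
set S := \sum_(i < n.+1) tau i in le_t.
have S0 : 0 < S.
  by rewrite /S (bigD1 ord0) //= ltr_pwDl // sumr_ge0 // => i _; apply: ltW.
have N0 : 0 < n.+1%:R :> R by rewrite ltr0n.
set N : R := n.+1%:R in N0 le_t.
(* Makes the mean slope [g = 4 eps / r]. The minimum is then [- 4 eps], and an expected value of at
   least [- 2 eps] leaves a gap of [2 eps]. *)
pose lam := 4 * eps * N / (r * S).
have lam0 : 0 < lam by rewrite /lam !(divr_gt0, mulr_gt0).
pose delta i := lam * tau i.
have delta0 i : 0 < delta i by rewrite mulr_gt0.
pose g := 4 * eps / r; have g0 : 0 < g by rewrite !(divr_gt0, mulr_gt0).
have gE : N^-1 * \sum_(i < n.+1) delta i = g.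
  rewrite -big_distrr /= -/S /lam /g.
  by field; rewrite !lt0r_neq0.
(* The variance is [delta_i^2 (1 - p_i) / p_i]: it is 0 if [p_i = 1], and at most [sigma2]
   otherwise. *)
pose p i := Num.min 1 (delta i ^+ 2 / sigma2).
have p_gt0 i : 0 < p i by rewrite lt_min ltr01 divr_gt0 ?exprn_gt0.
have p01 i : 0 <= p i <= 1 by rewrite ltW //= ge_min lexx.
have lep i : p i <= delta i ^+ 2 / sigma2 by rewrite ge_min lexx orbT.
pose Q := segment r.
have cQ : convex_set Q by apply: convex_segment.
have Q0 : Q 0 by rewrite /Q /segment /= mxE normr0 ltW.
have admA : admissible_algorithm Q (A 1%N Q) by apply: zrA => //; exists 0.
pose G s (i : 'I_n.+1) (x : 'rV[R]_1) (b : bool) : 'rV[R]_1 :=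
  const_mx (if b then s * delta i / p i else 0).
pose O s := fun i => delayed_oracle (tau i) (G s i).
pose silent : nat -> 'I_n.+1 -> bool := fun _ _ => false.
(* All answers of the silent run are 0 for either sign, so this is also the silent output for [O s],
   and [s] may be chosen from it. *)
pose out := iterate (A 1%N Q) (O 1) silent (last_index (A 1%N Q) (O 1) silent t).
pose s : R := if 0 <= out ord0 ord0 then 1 else -1.
have s1 : s ^+ 2 = 1 by rewrite /s; case: ifP; rewrite ?sqrrN expr1n.
have sout : 0 <= s * out ord0 ord0.
  by rewrite /s; case: ifP => [|/negbT]; rewrite ?mul1r // -ltNge mulN1r oppr_ge0 => /ltW.
have /= := segment_minimizer r0 g0 s1.
set f := dot _; set xs := const_mx _ => -[fxs mxs closest].
exists 1%N, Q, f, _, bool, (O s), (fun i => bernoulli_prob (p i)).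
split=> //.
- split=> [|x _|x y _ _]; first exact: convex_dot.
    exact: differentiable_dot.
  by rewrite !gradient_dot subrr enorm0 mulr_ge0 ?sqrtr_ge0 // ltW.
- exists (fun i => dot (const_mx (s * delta i))), (G s); split=> //.
  + move=> x; rewrite /f dot_dim1 mxE -gE -/N.
    under [in RHS]eq_bigr do rewrite dot_dim1 mxE.
    by rewrite -mulr_suml -mulr_sumr; ring.
  + by move=> i x _; apply: differentiable_dot.
  + move=> i x _ j; split; first exact: bernoulli_integrable.
    rewrite gradient_dot mxE; under eq_fun do rewrite mxE.
    by rewrite expectation_bernoulli // mulrC divfK // gt_eqF.
  + move=> i x _; rewrite gradient_dot unlock.
    rewrite integral_bernoulli_prob => [||b]; last 2 first.
      exact: p01.
      by rewrite lee_fin sqr_ge0.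
    rewrite !enorm_dim1 !real_normK ?num_real // !mxE /= -!EFinM -EFinD lee_fin.
    have -> : p i * (s * delta i / p i - s * delta i) ^+ 2
        + unstable.onem (p i) * (0 - s * delta i) ^+ 2
        = s ^+ 2 * (delta i ^+ 2 * (1 - p i) / p i).
      by rewrite /unstable.onem; field; rewrite gt_eqF.
    rewrite s1 mul1r ler_pdivrMr // /p minEle; case: ifP => _.
      by rewrite subrr mulr0 mulr1 ltW.
    rewrite [leRHS]mulrC divfK ?gt_eqF // ler_piMr ?sqr_ge0 //.
    by rewrite lerBlDr lerDl divr_ge0 ?sqr_ge0 // ltW.
- move=> dO Om P xi [mxi xiD _] F.
  have mF : measurable_fun setT F := measurable_final admA tau (G s) t0 mxi f.
  split=> //; rewrite (inf_minimizer mxs) fxs.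
  have fx x : f x = g * (s * x ord0 ord0) by rewrite /f dot_dim1 mxE; ring.
  have s1n : `|s| = 1.
    by apply/eqP; rewrite -sqr_norm_eq1 s1.
  have Fbound w : `|F w| <= g * r.
    rewrite /F fx normrM (gtr0_norm g0) normrM s1n mul1r ler_pM2l //.
    by have [_ _ + _] := admA; apply.
  have pD i : bernoulli_prob (p i) [set true] = (p i)%:E.
    by rewrite bernoulli_probE //= !diracE mem_set // memNset // mule1 mule0 adde0.
  have bad := probability_nonzero_answer admA (G s) t0 mxi
    (D := fun i => bernoulli_prob (p i)) xiD pD (fun i => ltW (p_gt0 i)) tau0.
  have EF : ((- (g * r * 2^-1))%:E <= 'E_P[F])%E.
    apply: (expectation_ge_bad_event mF
      (measurable_nonzero_answer _ _ _ _ mxi) _ Fbound) => //.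
    - by rewrite mulr_ge0 // ltW.
    - move=> w nbad; rewrite /F (silent_run admA t0 nbad) fx mulr_ge0 ?(ltW g0) //.
    - apply: le_trans bad _; rewrite lee_fin.
      apply: le_trans (_ : \sum_(i < n.+1) t * lam ^+ 2 / sigma2 * tau i <= _).
        apply: ler_sum => i _; apply: le_trans (ler_wpM2l _ (lep i)) _.
          by rewrite divr_ge0 // ltW.
        rewrite le_eqVlt; apply/orP; left; apply/eqP; rewrite /delta.
        by field; rewrite !lt0r_neq0.
      rewrite -mulr_sumr -/S.
      have -> : t * lam ^+ 2 / sigma2 * S =
          t * (16 * eps ^+ 2 * N ^+ 2 / (r ^+ 2 * sigma2 * S)).
        by rewrite /lam; field; rewrite ?(gt_eqF sigma0) ?(gt_eqF S0) ?(gt_eqF r0).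
      (* The constant [32^-1] against the factor 16 gives exactly [2^-1]. *)
      apply: le_trans (ler_wpM2r _ le_t) _.
        by rewrite !(divr_ge0, mulr_ge0) ?exprn_ge0 // ltW.
      rewrite le_eqVlt; apply/orP; left; apply/eqP.
      by field; rewrite !lt0r_neq0.
  apply: lt_le_trans (leeB EF (lexx _)).
  rewrite -EFinB lte_fin /g; rewrite divfK ?gt_eqF //; lra.
Qed.

Theorem theoremE5 (R : realType) :
  exists c c1 : R, 0 < c /\ 0 < c1 /\
  forall (n : nat) (sigma : R) (tau : 'I_n.+1 -> R),
    0 < sigma ^+ 2 ->
    (forall i, 0 < tau i) ->
    (forall i j : 'I_n.+1, (i <= j)%N -> tau i <= tau j) ->
  forall r L eps : R,
    0 < r -> 0 < L -> 0 < eps ->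
    c1 * Num.sqrt eps < Num.sqrt L * r ->
  forall t : R,
    0 <= t ->
    t <= c * (tau ord_max * (Num.sqrt L * r / Num.sqrt eps)
              + (n.+1%:R^-1 * \sum_(i < n.+1) tau i)
                * (sigma ^+ 2 * r ^+ 2 / (n.+1%:R * eps ^+ 2))) ->
  forall A : (forall d : nat, set 'rV[R]_d -> algorithm R n d),
    zr_class A ->
  exists (d : nat) (Q : set 'rV[R]_d) (f : 'rV[R]_d -> R)
         (dS : measure_display) (S : measurableType dS)
         (O : 'I_n.+1 -> oracle R d S) (D : 'I_n.+1 -> probability S R),
    [/\ convex_set Q /\ Q 0,
        smooth_convex_class Q L f,
        closest_minimizer_dist Q f r,
        oracle_class Q tau (sigma ^+ 2) f O D
      & forall (dO : measure_display) (Om : measurableType dO)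
               (P : probability Om R) (xi : nat * 'I_n.+1 -> Om -> S),
          independent_samples P D xi ->
          let F := fun w : Om =>
            let xiw := fun k i => xi (k, i) w in
            f (iterate (A d Q) O xiw (last_index (A d Q) O xiw t)) in
          measurable_fun [set: Om] F /\
          (eps%:E < 'E_P[F] - (inf (f @` Q))%:E)%E].
Proof.
(* Bounding the sum by twice its larger term turns [64^-1] into [32^-1]; the value 8 makes
   [a / 32 + 1 <= a / 4] below. *)
exists 64^-1, 8; do 2![split; first lra].
move=> n sigma tau sigma0 tau0 _ r L eps r0 L0 eps0 c1P t t0 le_t A zrA.
set T1 := tau ord_max * _ in le_t; set T2 := (X in _ + X) in le_t.
have [le_T12|lt_T21] := leP T1 T2.
  apply: (noisy_hard_instance sigma0 tau0 r0 L0 eps0 t0 zrA).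
  by rewrite -/T2; lra.
have seps0 : 0 < Num.sqrt eps by rewrite sqrtr_gt0.
pose a := Num.sqrt L * r / Num.sqrt eps.
have a8 : 8 < a by rewrite ltr_pdivlMr.
have {le_t lt_T21} le_t : t <= 32^-1 * (tau ord_max * a) by rewrite -/T1; lra.
(* Then [t <= tau_n a / 32 < tau_n (m + 1)], so at most [m] gradients are learned. *)
pose m := Num.truncn (a / 32).
have /andP[le_m lt_m] : m%:R <= a / 32 < m.+1%:R.
  by apply: truncn_itv; lra.
have N0 : 0 < m.+1%:R :> R by rewrite ltr0n.
apply: (noiseless_hard_instance (m := m) (ltW sigma0) tau0 r0 L0 t0 zrA).
  apply: le_lt_trans le_t _; rewrite mulrCA ltr_pM2l //; lra.
have le_m8 : m.+1%:R <= a / 4 by rewrite -natr1; lra.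
have a2 : a ^+ 2 * eps = L * r ^+ 2.
  by rewrite /a !exprMn exprVn !sqr_sqrtr ?ltW // divfK // gt_eqF.
have -> : L / 8 * (r ^+ 2 / m.+1%:R ^+ 2) = a ^+ 2 * eps / (8 * m.+1%:R ^+ 2).
  by rewrite a2; field; rewrite gt_eqF.
rewrite ltr_pdivlMr ?mulr_gt0 ?exprn_gt0 // mulrC ltr_pM2r //.
(* With [m + 1 <= a / 4] the gap [a^2 eps / (8 (m + 1)^2)] is at least [2 eps]. *)
have : m.+1%:R ^+ 2 <= (a / 4) ^+ 2 by rewrite ler_sqr ?nnegrE //; lra.
nra.
Qed.
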